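(* Let $p,q$ be positive integers with $q$ divisible by $p$, and let $L$ be the $(p,q)$-torus link (it has $p$ components, each of them unknotted and any two of them non-trivially linked). Then the hull number of $L$ satisfies $$u(L)\ \ge\ \frac{3}{5}\,p .$$
   Context: A link is an ambient isotopy class of a union of disjoint simple closed curves in $\mathbb{R}^3$; the same letter $L$ is used for a link and for a union of curves representing it. The $(p,q)$-torus link is the link formed by $\gcd(p,q)$ parallel disjoint simple closed curves on a standardly embedded (unknotted) torus in $\mathbb{R}^3$, in total homology class $p$ times one and $q$ times the other of the two standard generators (meridian and parallel). For a union $L$ of disjoint simple closed curves in $\mathbb{R}^3$, the $n$-th hull of $L$ is $$h_n(L)=\{c\in\mathbb{R}^3 : |S\cap L|\ge 2n \text{ for every plane } S\ni c\}.$$ Counting convention for $|S\cap L|$: an isolated intersection point at which the curve does not change sides with respect to $S$ is counted twice; if there is a non-isolated intersection point the count is infinite. The hull number of a link $L$ is $$u(L)=\max\{n : h_n(L')\neq\emptyset \text{ for every union of curves } L' \text{ representing the link } L\}.$$ *)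

(* Defs.v *)
From mathcomp Require Import all_boot all_order all_algebra.
From mathcomp Require Import all_classical all_reals all_analysis.
Import Order.TTheory GRing.Theory Num.Theory.
Import numFieldNormedType.Exports.

Set Implicit Arguments.
Unset Strict Implicit.
Unset Printing Implicit Defensive.

Local Open Scope classical_set_scope.
Local Open Scope ring_scope.

Definition simple_closed_curve (R : realType) (C : set 'rV[R]_3) : Prop :=
  exists g : R -> 'rV[R]_3,
    [/\ {within `[0, 1], continuous g},
        g 0 = g 1,
        {in `[0, 1[ &, injective g} &
        C = g @` `[0, 1]].

Definition union_of_curves (R : realType) (L : set 'rV[R]_3) : Prop :=
  exists (k : nat) (C : 'I_k -> set 'rV[R]_3),
    [/\ forall i, simple_closed_curve (C i),
        trivIset setT C &
        L = \bigcup_i C i].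

Definition homeomorphism (R : realType) (f : 'rV[R]_3 -> 'rV[R]_3) : Prop :=
  exists g : 'rV[R]_3 -> 'rV[R]_3,
    [/\ continuous f, continuous g, cancel f g & cancel g f].

Definition ambient_isotopic (R : realType) (A B : set 'rV[R]_3) : Prop :=
  exists H : R -> 'rV[R]_3 -> 'rV[R]_3,
    [/\ {within `[0, 1] `*` [set: 'rV[R]_3],
           continuous (fun z : R * 'rV[R]_3 => H z.1 z.2)},
        forall t, t \in `[0, 1] -> homeomorphism (H t),
        forall x, H 0 x = x &
        H 1 @` A = B].

(* A link is the collection of all its representatives. *)
Definition link_of (R : realType) (A : set 'rV[R]_3) : set (set 'rV[R]_3) :=
  [set L | union_of_curves L /\ ambient_isotopic A L].

(* Signed height above the plane {x | <a, x> = b}; its sign is the side. *)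
Definition height (R : realType) (a : 'rV[R]_3) (b : R) (x : 'rV[R]_3) : R :=
  \sum_(i < 3) a 0 i * x 0 i - b.

Definition plane (R : realType) (a : 'rV[R]_3) (b : R) : set 'rV[R]_3 :=
  [set x | height a b x = 0].

(* L locally stays in one of the two closed half-spaces.  At an isolated point
   of S `&` L the two arcs of L leaving x avoid S, so each lies on one strict
   side of S, and this says that the two sides agree. *)
Definition keeps_side (R : realType) (a : 'rV[R]_3) (b : R)
    (L : set 'rV[R]_3) (x : 'rV[R]_3) : Prop :=
  (\forall y \near x, L y -> 0 <= height a b y) \/
  (\forall y \near x, L y -> height a b y <= 0).

Definition multiplicity (R : realType) (a : 'rV[R]_3) (b : R)
    (L : set 'rV[R]_3) (x : 'rV[R]_3) : \bar R :=
  if ~~ `[< isolated (plane a b `&` L) x >] then +oo%E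
  else if `[< keeps_side a b L x >] then 2%:E else 1%:E.

Definition intersection_count (R : realType) (a : 'rV[R]_3) (b : R)
    (L : set 'rV[R]_3) : \bar R :=
  \esum_(x in plane a b `&` L) multiplicity a b L x.

Definition hull (R : realType) (n : nat) (L : set 'rV[R]_3) : set 'rV[R]_3 :=
  [set c | forall (a : 'rV[R]_3) (b : R), a != 0 -> plane a b c ->
             ((2 * n)%:R%:E <= intersection_count a b L)%E].

Definition hull_orders (R : realType) (K : set (set 'rV[R]_3)) : set nat :=
  [set n | forall L, K L -> hull n L !=set0].

(* The maximum of hull_orders K, with value +oo if there is none:
   see hull_numberP. *)
Definition hull_number (R : realType) (K : set (set 'rV[R]_3)) : \bar R :=
  ereal_sup [set n%:R%:E | n in hull_orders K].

Lemma hull_orders0 (R : realType) (K : set (set 'rV[R]_3)) : hull_orders K 0%N.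
Proof.
move=> L _; exists 0 => a b _ _; rewrite muln0; apply: esum_ge0 => x _.
by rewrite /multiplicity; do 2![case: ifP => // _]; rewrite lee_fin.
Qed.

Lemma hull_numberP (R : realType) (K : set (set 'rV[R]_3)) (u : nat) :
  hull_number K = u%:R%:E <->
  hull_orders K u /\ (forall n, hull_orders K n -> (n <= u)%N).
Proof.
split=> [Ku | [uK ubu]].
  have ubu n : hull_orders K n -> (n <= u)%N.
    move=> nK; rewrite -(ler_nat R) -lee_fin -Ku.
    by apply: ereal_sup_ubound; exists n.
  split=> //; apply: contrapT => uNK.
  have lt_u n : hull_orders K n -> (n < u)%N.
    move=> nK; rewrite ltn_neqAle ubu // andbT.
    by apply/eqP => nu; apply: uNK; rewrite -nu.
  have u0 : (0 < u)%N by apply: lt_u; exact: hull_orders0.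
  have : (hull_number K <= u.-1%:R%:E)%E.
    apply: ge_ereal_sup => _ [n /lt_u nu <-].
    by rewrite lee_fin ler_nat -ltnS prednK.
  by rewrite Ku lee_fin ler_nat -ltnS prednK // ltnn.
apply/eqP; rewrite eq_le; apply/andP; split.
  by apply: ge_ereal_sup => _ [n /ubu nu <-]; rewrite lee_fin ler_nat.
by apply: ereal_sup_ubound; exists u.
Qed.

Lemma hull_number_pinfty (R : realType) (K : set (set 'rV[R]_3)) :
  hull_number K = +oo%E <->
  ~ exists u, hull_orders K u /\ (forall n, hull_orders K n -> (n <= u)%N).
Proof.
split=> [Ky [u /hull_numberP]|noK]; first by rewrite Ky.
have arb m : exists2 n, hull_orders K n & (m <= n)%N.
  elim: m => [|m [n nK mn]]; first by exists 0%N => //; exact: hull_orders0.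
  apply: contrapT => bnd; apply: noK; exists n; split=> // k kK.
  rewrite leqNgt; apply/negP => nk; apply: bnd.
  by exists k => //; exact: leq_ltn_trans mn nk.
apply/eqyP => r r0; have [n nK rn] := arb (Num.bound r).
apply: (@le_trans _ _ n%:R%:E); last by apply: ereal_sup_ubound; exists n.
rewrite lee_fin; apply: le_trans (ltW (archi_boundP (ltW r0))) _.
by rewrite ler_nat.
Qed.

(* Angles are in full turns: s along the parallel, t along the meridian. *)
Definition torus_point (R : realType) (s t : R) : 'rV[R]_3 :=
  let theta := 2 * pi * s in
  let phi := 2 * pi * t in
  \row_(i < 3) [:: (2 + cos phi) * cos theta;
                   (2 + cos phi) * sin theta;
                   sin phi]`_i.

(* The d = gcd(p, q) curves of slope (p / d, q / d) starting at the points
   torus_point 0 (j / p).  For p > 0 they are disjoint: the curve j meets the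
   meridian s = 0 at the points t = (q m + j) / p modulo 1, m an integer. *)
Definition torus_curves (R : realType) (p q : nat) : set 'rV[R]_3 :=
  let d := gcdn p q in
  \bigcup_(j in `I_d)
    ((fun t : R => torus_point ((p %/ d)%N%:R * t)
                               ((q %/ d)%N%:R * t + j%:R / p%:R)) @` `[0, 1]).

Definition torus_link (R : realType) (p q : nat) : set (set 'rV[R]_3) :=
  link_of (@torus_curves R p q).
Arguments torus_link : clear implicits.

(* Main.v *)
(** If the convex hull of one component of a curve L' isotopic to the torus
    link missed another component, then the first could be contracted off
    the second inside its hull; carried back by the isotopy, this would be a
    null-homotopy of one component of the standard link in the complement of
    another. That complement carries the nowhere zero complex function w -
    e^(i(k theta + 2 pi c)), with k = q / p, which winds k > 0 times along
    the first component. Hence the convex hull of each component meets every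
    other component.

    Helly's theorem now gives a point c in the convex hull of the union of
    any more than 2p/5 components: given four such families, a weighting of
    the families shows that two components i, j have the property that each
    family contains i or j, and a point common to component j and the hull
    of component i lies in all four hulls. The components missed by a plane
    through c all lie on the same side of it, so there are at most 2p/5 of
    them; each of the others contributes at least 2 to the intersection
    count. *)
Require Import Defs.
From mathcomp Require Import all_boot all_order all_algebra.
From mathcomp Require Import all_classical all_reals all_analysis.
From mathcomp Require Import ring lra zify.
Import Order.TTheory GRing.Theory Num.Theory.
Import numFieldNormedType.Exports.
Set Implicit Arguments.
Unset Strict Implicit.
Unset Printing Implicit Defensive.
Local Open Scope classical_set_scope.
Local Open Scope ring_scope.

(** * Convexity and Helly's theorem *)

Section Convexity.
Context {R : realType} {V : lmodType R}.
Implicit Types A C : set (convex_lmodType V).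

Lemma convex_setP A : convex_set A <->
  forall x y t, A x -> A y -> 0 <= t <= 1 -> A (t *: x + (1 - t) *: y).
Proof.
split=> [cA x y t Ax Ay t01|cA x y l /set_mem Ax /set_mem Ay].
  have := cA x y (Itv01 (andP t01).1 (andP t01).2) (mem_set Ax) (mem_set Ay).
  by move/set_mem.
by apply/mem_set; apply: cA => //; apply/andP; split.
Qed.

Definition convex_hull A := smallest (@convex_set R V) A.

Lemma convex_hull_convex A : convex_set (convex_hull A).
Proof.
apply/convex_setP => x y t Ax Ay t01 C [cC AC].
by move/convex_setP : (cC); apply=> //; [apply: Ax | apply: Ay].
Qed.

(** Induction on the list, renormalising the weights at each step. The weights are not normalised
    and membership is asked only where they are positive, so the positive part of an affine
    dependence can be used directly. *)
Lemma convex_combination (I : eqType) (r : seq I) (w : I -> R) (x : I -> V) A :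
  convex_set A -> (forall i, 0 <= w i) -> (forall i, 0 < w i -> A (x i)) ->
  0 < \sum_(i <- r) w i ->
  A ((\sum_(i <- r) w i)^-1 *: \sum_(i <- r) w i *: x i).
Proof.
move=> /convex_setP cA w0 xA.
elim: r => [|i r IH]; first by rewrite big_nil ltxx.
rewrite !big_cons.
set W := \sum_(j <- r) w j; set S := \sum_(j <- r) _.
have W0 : 0 <= W by exact: sumr_ge0.
move=> Wi.
have [wi|wi] : 0 < w i \/ w i = 0.
  by have := w0 i; rewrite le_eqVlt => /orP[/eqP <-|]; [right|left].
- have [Wp|Wz] : 0 < W \/ W = 0.
    by move: W0; rewrite le_eqVlt => /orP[/eqP <-|]; [right|left].
  + have -> : (w i + W)^-1 *: (w i *: x i + S) =
      (w i / (w i + W)) *: x i + (1 - w i / (w i + W)) *: (W^-1 *: S).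
      rewrite scalerDr !scalerA mulrC; congr (_ + _ *: _).
      by field; rewrite !gt_eqF.
    apply: cA; [exact: xA|exact: IH|].
    by rewrite divr_ge0 ?(ltW Wi)//= ler_pdivrMr// mul1r lerDl.
  + have -> : S = 0.
      rewrite /S; move: Wz; rewrite /W => /eqP.
      rewrite psumr_eq0// => /allP h; rewrite big_seq big1// => j jr.
      by have /eqP -> := h _ jr; rewrite scale0r.
    rewrite Wz !addr0 scalerA mulVf ?scale1r ?gt_eqF//; exact: xA.
- rewrite wi add0r scale0r add0r; apply: IH.
  by move: Wi; rewrite wi add0r.
Qed.

End Convexity.

(** Appending a coordinate 1 to each point gives a matrix of rank at most [d + 1], which is less
    than its number of rows; a nonzero vector of its left kernel is the dependence. *)
Lemma affine_dependence (K : fieldType) (d n : nat) (x : 'I_n -> 'rV[K]_d) :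
  (d.+1 < n)%N -> exists a : 'I_n -> K,
    [/\ exists i, a i != 0, \sum_i a i = 0 & \sum_i a i *: x i = 0].
Proof.
move=> dn; pose M : 'M[K]_(n, d + 1) := \matrix_(i < n) row_mx (x i) (const_mx 1).
have /rowV0Pn[v vM v0] : kermx M != 0.
  rewrite -mxrank_eq0 mxrank_ker -lt0n subn_gt0.
  by rewrite (leq_ltn_trans (rank_leq_col M))// addn1.
have := sub_kermxP vM; rewrite mulmx_sum_row.
under eq_bigr do rewrite rowK scale_row_mx.
move=> S0; exists (v 0); split.
- by have /rV0Pn := v0.
- transitivity (rsubmx (0 : 'rV[K]_(d + 1)) 0 0); last by rewrite !mxE.
  rewrite -S0 linear_sum summxE; apply: eq_bigr => i _.
  by rewrite /= row_mxKr !mxE mulr1.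
- transitivity (lsubmx (0 : 'rV[K]_(d + 1))); last exact: linear0.
  by rewrite -S0 linear_sum; apply: eq_bigr => i _; rewrite /= row_mxKl.
Qed.

(** Radon's proof, by induction on the number of sets. The selections [s] may repeat indices, so
    families of fewer than [d.+1] sets are covered too. *)
Lemma helly (R : realType) (d n : nat) (F : 'I_n -> set 'rV[R]_d) :
  (forall i, convex_set (F i)) ->
  (forall s : 'I_d.+1 -> 'I_n, exists x, forall k, F (s k) x) ->
  exists x, forall i, F i x.
Proof.
elim: n F => [|n IH] F cF hF; first by exists 0 => -[].
have [nd|dn] := leqP n d.
  have [x Fx] := hF (fun k => inord k); exists x => i.
  have id : (i < d.+1)%N by exact: leq_trans (ltn_ord i) _.
  by have := Fx (Ordinal id); rewrite /= inord_val.
(* By induction, the sets other than [F i] have a common point [x i]. *)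
have /choice[x Fx] (i : 'I_n.+1) : exists x, forall j, j != i -> F j x.
  have [x Fx] : exists x, forall j, F (lift i j) x.
    apply: IH => [j|s]; first exact: cF.
    exact: hF (lift i \o s).
  by exists x => j; rewrite eq_sym => /unlift_some[k -> _].
have [a [[i0 ai0] a0 ax0]] := affine_dependence x dn.
(* The positive and negative parts of the dependence have the same total and the same weighted sum,
   so both describe the same point, the Radon point. *)
pose w i := Num.max (a i) 0; pose w' i := Num.max (- a i) 0.
have ww' i : a i = w i - w' i.
  rewrite /w /w'; have [ai|ai] := leP (a i) 0.
    by rewrite max_l ?oppr_ge0// sub0r opprK.
  by rewrite max_r ?subr0// oppr_le0 ltW.
have w0 i : 0 <= w i by rewrite /w le_max lexx orbT.
have w'0 i : 0 <= w' i by rewrite /w' le_max lexx orbT.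
have Sw : \sum_i w i = \sum_i w' i.
  by apply/eqP; rewrite -subr_eq0 -sumrB -[eqbRHS]a0; apply/eqP/eq_bigr.
have Swx : \sum_i w i *: x i = \sum_i w' i *: x i.
  apply/eqP; rewrite -subr_eq0 -sumrB -[eqbRHS]ax0; apply/eqP/eq_bigr => i _.
  by rewrite -scalerBl ww'.
have W0 : 0 < \sum_i w i.
  rewrite lt_def sumr_ge0// andbT; apply/eqP => S0.
  have S0' : \sum_i w' i = 0 by rewrite -Sw.
  move/eqP: S0; rewrite psumr_eq0// => /allP/(_ i0 (mem_index_enum _))/eqP wi.
  move/eqP: S0'; rewrite psumr_eq0// => /allP/(_ i0 (mem_index_enum _))/eqP wi'.
  by move: ai0; rewrite ww' wi wi' subrr eqxx.
exists ((\sum_i w i)^-1 *: \sum_i w i *: x i) => j.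
(* Of the two expressions of the Radon point, the one giving [j] weight zero only involves points
   [x i] with [i != j], all of them in [F j]. *)
have [aj|aj] := ltrP 0 (a j).
- rewrite Sw Swx; apply: convex_combination => // [i|]; last by rewrite -Sw.
  rewrite /w' lt_max ltxx orbF oppr_gt0 => ai; apply: Fx.
  by apply/eqP => ij; move: ai; rewrite -ij ltNge ltW.
- apply: convex_combination => // i.
  rewrite /w lt_max ltxx orbF => ai; apply: Fx.
  by apply/eqP => ij; move: ai; rewrite -ij ltNge aj.
Qed.

(* Otherwise the complementary sets of indices k with i \notin A k pairwise
   meet. An intersecting family of subsets of {0, 1, 2, 3} is weighed
   against one of the weights (1, 0, 0, 0), (1, 1, 1, 0), (2, 1, 1, 1), up
   to permutation: each of its members has at least 3/5 of the total weight. *)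
Lemma four_sets_pair_cover (I : finType) (A : 'I_4 -> {set I}) :
  (forall k, 2 * #|I| < 5 * #|A k|)%N ->
  exists i j, forall k, (i \in A k) || (j \in A k).
Proof.
move=> bigA; apply: contrapT => noij.
pose a i := i \in A (inord 0); pose b i := i \in A (inord 1).
pose c i := i \in A (inord 2); pose d i := i \in A (inord 3).
have nc i j :
    ~~ [&& a i || a j, b i || b j, c i || c j & d i || d j].
  apply/negP => /and4P[ha hb hc hd]; apply: noij; exists i, j => k.
  by rewrite -[k]inord_val; case: (k : nat) (ltn_ord k) => [|[|[|[|]]]].
(* Double counting: each [A k] has more than 2/5 of the elements, so for any nonzero weights some
   element lies in sets carrying more than 2/5 of the total weight. *)
have weights (x y z t : nat) : (0 < x + y + z + t)%N ->
    ~ forall i, (5 * (x * a i + y * b i + z * c i + t * d i)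
                 <= 2 * (x + y + z + t))%N.
  move=> w0 h.
  have : (\sum_i 5 * (x * a i + y * b i + z * c i + t * d i)
          <= #|I| * (2 * (x + y + z + t)))%N.
    by rewrite -sum_nat_const; exact: leq_sum.
  rewrite -big_distrr/= !big_split/= -!big_distrr/=.
  have card k : (\sum_i (i \in A k) = #|A k|)%N.
    by rewrite -sum1_card [RHS]big_mkcond; apply: eq_bigr => i _; case: ifP.
  rewrite !card.
  have le w k : (w * (2 * #|I|).+1 <= w * (5 * #|A k|))%N by rewrite leq_mul.
  have := le x (inord 0); have := le y (inord 1); have := le z (inord 2).
  have := le t (inord 3); move: #|I| => N.
  move: #|A (inord 0)| #|A (inord 1)| #|A (inord 2)| #|A (inord 3)| => *; lia.
have pairs (f g f' g' : I -> bool) :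
    (forall i j, [&& f i, g i, f' j & g' j] ->
       [&& a i || a j, b i || b j, c i || c j & d i || d j]) ->
    (forall i, ~~ (f i && g i)) \/ (forall i, ~~ (f' i && g' i)).
  move=> fg; apply: contrapT => /not_orP[].
  move=> /existsNP[i /negP/negPn/andP[fi gi]].
  move=> /existsNP[j /negP/negPn/andP[fj gj]].
  by have := nc i j; rewrite fg ?fi ?gi ?fj ?gj.
have dis i : ~~ [&& a i, b i, c i & d i] by have := nc i i; rewrite !orbb.
(* An element of three of the sets would form a covering pair with any element of the fourth, which
   must then be empty. *)
have [abc|abc] := pselect (exists i, [&& a i, b i & c i]).
  have [i /and3P[ai bi ci]] := abc; apply: (weights 0 0 0 1)%N => // j.
  by move: (nc i j); rewrite ai bi ci /=; case: (d i) (d j) (dis i) => -[]; rewrite ?ai ?bi ?ci.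
have [abd|abd] := pselect (exists i, [&& a i, b i & d i]).
  have [i /and3P[ai bi di]] := abd; apply: (weights 0 0 1 0)%N => // j.
  by move: (nc i j); rewrite ai bi di /=; case: (c i) (c j) (dis i) => -[]; rewrite ?ai ?bi ?di.
have [acd|acd] := pselect (exists i, [&& a i, c i & d i]).
  have [i /and3P[ai ci di]] := acd; apply: (weights 0 1 0 0)%N => // j.
  by move: (nc i j); rewrite ai ci di /=; case: (b i) (b j) (dis i) => -[]; rewrite ?ai ?ci ?di.
have [bcd|bcd] := pselect (exists i, [&& b i, c i & d i]).
  have [i /and3P[bi ci di]] := bcd; apply: (weights 1 0 0 0)%N => // j.
  by move: (nc i j); rewrite bi ci di /=; case: (a i) (a j) (dis i) => -[]; rewrite ?bi ?ci ?di.
have triples i : [&& ~~ [&& a i, b i & c i], ~~ [&& a i, b i & d i],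
    ~~ [&& a i, c i & d i] & ~~ [&& b i, c i & d i]].
  by apply/and4P; split; apply/negP => h;
    [apply: abc|apply: abd|apply: acd|apply: bcd]; exists i.
(* Each of the three splittings of the four sets into two pairs contains a disjoint pair. The chosen
   disjoint pairs form a star, weighted 2 at its centre and 1 elsewhere, or a triangle, weighted 1
   on its vertices and 0 on the fourth set. *)
have ab_cd : (forall i, ~~ (a i && b i)) \/ (forall i, ~~ (c i && d i)).
  by apply: pairs => i j /and4P[-> -> -> ->]; rewrite !orbT.
have ac_bd : (forall i, ~~ (a i && c i)) \/ (forall i, ~~ (b i && d i)).
  by apply: pairs => i j /and4P[-> -> -> ->]; rewrite !orbT.
have ad_bc : (forall i, ~~ (a i && d i)) \/ (forall i, ~~ (b i && c i)).
  by apply: pairs => i j /and4P[-> -> -> ->]; rewrite !orbT.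
have fin (f g h : I -> bool) (x y z t : nat) : (0 < x + y + z + t)%N ->
    (forall i, ~~ f i) -> (forall i, ~~ g i) -> (forall i, ~~ h i) ->
    ~ (forall i, ~~ f i -> ~~ g i -> ~~ h i ->
     (5 * (x * a i + y * b i + z * c i + t * d i) <= 2 * (x + y + z + t))%N).
  by move=> w0 fi gi hi H; apply: (weights _ _ _ _ w0) => i; exact: H.
case: ab_cd => h1; case: ac_bd => h2; case: ad_bc => h3.
- apply: (fin _ _ _ 2 1 1 1 _ h1 h2 h3)%N => // i; move: (triples i).
  by case: (a i) (b i) (c i) (d i) => -[] [] [].
- apply: (fin _ _ _ 1 1 1 0 _ h1 h2 h3)%N => // i; move: (triples i).
  by case: (a i) (b i) (c i) (d i) => -[] [] [].
- apply: (fin _ _ _ 1 1 0 1 _ h1 h2 h3)%N => // i; move: (triples i).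
  by case: (a i) (b i) (c i) (d i) => -[] [] [].
- apply: (fin _ _ _ 1 2 1 1 _ h1 h2 h3)%N => // i; move: (triples i).
  by case: (a i) (b i) (c i) (d i) => -[] [] [].
- apply: (fin _ _ _ 1 0 1 1 _ h1 h2 h3)%N => // i; move: (triples i).
  by case: (a i) (b i) (c i) (d i) => -[] [] [].
- apply: (fin _ _ _ 1 1 2 1 _ h1 h2 h3)%N => // i; move: (triples i).
  by case: (a i) (b i) (c i) (d i) => -[] [] [].
- apply: (fin _ _ _ 1 1 1 2 _ h1 h2 h3)%N => // i; move: (triples i).
  by case: (a i) (b i) (c i) (d i) => -[] [] [].
- apply: (fin _ _ _ 0 1 1 1 _ h1 h2 h3)%N => // i; move: (triples i).
  by case: (a i) (b i) (c i) (d i) => -[] [] [].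
Qed.

Lemma deep_point (R : realType) (p : nat) (K : 'I_p -> set 'rV[R]_3) :
  (forall i, K i !=set0) ->
  (forall i j, i != j -> convex_hull (K i) `&` K j !=set0) ->
  exists c, forall A : {set 'I_p}, (2 * p < 5 * #|A|)%N ->
    convex_hull (\bigcup_(i in [set` A]) K i) c.
Proof.
move=> K0 Kij; pose T := [set A : {set 'I_p} | (2 * p < 5 * #|A|)%N]%SET.
pose F (m : 'I_#|T|) := convex_hull (\bigcup_(i in [set` (enum_val m)]) K i).
have [c Fc] : exists c, forall m, F m c.
  apply: helly => [m|s]; first exact: convex_hull_convex.
  have [k|i [j ij]] := @four_sets_pair_cover _ (fun k => enum_val (s k)).
    by have := enum_valP (s k); rewrite inE card_ord.
  have KF l k x : l \in enum_val (s k) -> convex_hull (K l) x -> F (s k) x.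
    move=> lk; apply: sub_smallest2r; first exact: convex_hull_convex.
    move=> y Ky; exists l => //.
  have Kh l x : K l x -> convex_hull (K l) x by exact: sub_gen_smallest.
  have [x [Kix Kjx]] : exists x, convex_hull (K i) x /\ convex_hull (K j) x.
    (* The covering pair may consist of a single index; any point of that component then serves. *)
    have [->|ij'] := eqVneq i j.
      by have [x Kx] := K0 j; exists x; split; exact: Kh.
    by have [x [? ?]] := Kij _ _ ij'; exists x; split=> //; exact: Kh.
  by exists x => k; case/orP: (ij k) => /KF; apply.
exists c => A bigA; have AT : A \in T by rewrite inE.
by have := Fc (enum_rank_in AT A); rewrite /F enum_rankK_in.
Qed.

(** * Winding numbers *)

Section Winding.
Context {R : realType}.

(** A positive dot product puts the angle between the two vectors in the range of [atan], and its
    tangent is the cross product over the dot product. The factor [r] is the ratio of the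
    lengths. *)
Lemma rotation_atan (a b a' b' : R) : 0 < a * a' + b * b' ->
  let w := atan ((a * b' - b * a') / (a * a' + b * b')) in
  exists2 r, 0 < r &
    a' = r * (cos w * a - sin w * b) /\ b' = r * (sin w * a + cos w * b).
Proof.
set D := a * a' + b * b'; set X := a * b' - b * a' => D0 w.
have C0 : 0 < cos w by rewrite cos_gt0_pihalf// atan_gtNpi2 atan_ltpi2.
have sinw : sin w = X / D * cos w.
  by rewrite -[X / D]atanK /tan -/w divfK// gt_eqF.
have q0 : 0 < a ^+ 2 + b ^+ 2.
  rewrite lt_def addr_ge0 ?sqr_ge0// andbT paddr_eq0 ?sqr_ge0// !sqrf_eq0.
  by apply/negP => /andP[/eqP a0 /eqP b0]; move: D0; rewrite /D a0 b0; lra.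
exists (D / ((a ^+ 2 + b ^+ 2) * cos w)); first by rewrite divr_gt0// mulr_gt0.
rewrite sinw /X /D; split; field; rewrite !gt_eqF//.
Qed.

(** The sum of the small angles is a discrete substitute for a continuous lift of the argument along
    a path. *)
Lemma rotation_sum_atan (a b : nat -> R) (n : nat) :
  let D m := a m * a m.+1 + b m * b m.+1 in
  let w := \sum_(m < n) atan ((a m * b m.+1 - b m * a m.+1) / D m) in
  (forall m, (m < n)%N -> 0 < D m) ->
  exists2 r, 0 < r &
    a n = r * (cos w * a 0 - sin w * b 0) /\
    b n = r * (sin w * a 0 + cos w * b 0).
Proof.
move=> D; elim: n => [|n IH] /=.
  by exists 1 => //; rewrite big_ord0 cos0 sin0; split; ring.
move=> D0; have [m mn|r r0 [an bn]] := IH; first by rewrite D0// ltnW.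
rewrite big_ord_recr/= cosD sinD.
have [r' r'0] := rotation_atan (D0 _ (ltnSn n)).
rewrite -/(D n); set w := atan _; rewrite an bn.
set W := \sum_(_ < _) _ => -[-> ->].
by exists (r' * r); [exact: mulr_gt0|split; ring].
Qed.

(** For step zero the expression is the squared length of a nonzero vector; compactness of the unit
    square makes one small step work everywhere. *)
Lemma eventually_dot_gt0 (u v : R -> R -> R) :
  continuous (fun z : R * R => u z.1 z.2) ->
  continuous (fun z : R * R => v z.1 z.2) ->
  (forall s t, 0 <= s <= 1 -> 0 <= t <= 1 -> u s t != 0 \/ v s t != 0) ->
  \forall n \near \oo, forall s t, 0 <= s <= 1 -> 0 <= t <= 1 ->
    0 < u s t * u s (t + n.+1%:R^-1) + v s t * v s (t + n.+1%:R^-1).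
Proof.
move=> uC vC uv0.
have := @compact_setX R R _ _ (@segment_compact R 0 1) (@segment_compact R 0 1).
move=> /compact_near_coveringP/(_ nat \oo (fun n z =>
  0 < u z.1 z.2 * u z.1 (z.2 + n.+1%:R^-1)
      + v z.1 z.2 * v z.1 (z.2 + n.+1%:R^-1)) _) [|n _ nP].
- move=> [s t] [/= s01 t01].
  pose D (w : (R * R) * nat) := u w.1.1 w.1.2 * u w.1.1 (w.1.2 + w.2.+1%:R^-1)
      + v w.1.1 w.1.2 * v w.1.1 (w.1.2 + w.2.+1%:R^-1).
  have D0 : 0 < u s t * u s t + v s t * v s t.
    rewrite !in_itv/= in s01 t01; have h := uv0 s t s01 t01.
    rewrite lt_def addr_ge0 -?expr2 ?sqr_ge0// andbT paddr_eq0 ?sqr_ge0//.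
    rewrite !sqrf_eq0; apply/negP => /andP[/eqP a0 /eqP b0].
    by case: h => /eqP.
  suff : D w @[w --> (nbhs (s, t), \oo)] --> u s t * u s t + v s t * v s t.
    by move/cvgr_gt => /(_ _ D0).
  pose F := filter_prod (nbhs (s, t)) (\oo : set_system nat).
  have w1 : w.1 @[w --> F] --> (s, t) by exact: cvg_fst.
  have w11 : w.1.1 @[w --> F] --> s by apply: (cvg_comp _ _ w1); exact: cvg_fst.
  have w12 : w.1.2 @[w --> F] --> t by apply: (cvg_comp _ _ w1); exact: cvg_snd.
  have w12' : w.1.2 + w.2.+1%:R^-1 @[w --> F] --> t.
    rewrite -{1}(addr0 t); apply: cvgD => //.
    apply: (cvg_comp _ (@harmonic R)); [exact: cvg_snd|exact: cvg_harmonic].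
  have FF : ProperFilter F by exact: filter_prod_proper.
  apply: cvgD; apply: cvgM.
  - exact: (continuous2_cvg _ (uC (s, t)) w11 w12).
  - exact: (continuous2_cvg _ (uC (s, t)) w11 w12').
  - exact: (continuous2_cvg _ (vC (s, t)) w11 w12).
  - exact: (continuous2_cvg _ (vC (s, t)) w11 w12').
- exists n => // m nm s t s01 t01; apply: (nP m nm (s, t)).
  by split; rewrite /= in_itv.
Qed.

Lemma continuous_slice (u : R -> R -> R) (t : R) :
  continuous (fun z : R * R => u z.1 z.2) -> continuous (u^~ t).
Proof.
by move=> uC s; apply: (continuous2_cvg _ (uC (s, t))); [exact: cvg_id|exact: cvg_cst].
Qed.

(** The total angle [W s] of the loop at time [s] is continuous in [s] and always a zero of [sin].
    It would go from [2 * pi * k] to 0, so for [k > 0] it would take the value [pi / 2], where [sin]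
    is 1. *)
Lemma winding_not_null_homotopic (u v : R -> R -> R) (k : nat) (A c : R) :
  continuous (fun z : R * R => u z.1 z.2) ->
  continuous (fun z : R * R => v z.1 z.2) ->
  (forall s t, 0 <= s <= 1 -> 0 <= t <= 1 -> u s t != 0 \/ v s t != 0) ->
  (forall s, u s 1 = u s 0 /\ v s 1 = v s 0) ->
  (forall t, u 1 t = u 1 0 /\ v 1 t = v 1 0) ->
  (forall t, u 0 t = A * cos (2 * pi * (k%:R * t) + c)) ->
  (forall t, v 0 t = A * sin (2 * pi * (k%:R * t) + c)) ->
  A != 0 -> k = 0%N.
Proof.
move=> uC vC uv0 per uv1 u0E v0E A0; apply/eqP; rewrite -leqn0 leqNgt.
apply/negP => k0.
(* Having more than [4 * k] steps keeps each increment [2 * pi * k / M] of the initial loop below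
   [pi / 2], so that [atan] recovers it exactly. *)
have [n nk dot0] : exists2 n, (4 * k < n.+1)%N & forall s t,
    0 <= s <= 1 -> 0 <= t <= 1 ->
    0 < u s t * u s (t + n.+1%:R^-1) + v s t * v s (t + n.+1%:R^-1).
  have [n0 _ n0P] := eventually_dot_gt0 uC vC uv0.
  exists (n0 + 4 * k)%N; first by rewrite ltnS leq_addl.
  by apply: n0P; rewrite /= leq_addr.
set M := n.+1 in nk dot0; set h := (M%:R : R)^-1 in dot0.
have Mh : M%:R * h = 1 by rewrite mulfV ?pnatr_eq0.
have h0 : 0 < h by rewrite invr_gt0 ltr0n.
have k0' : 0 < (k%:R : R) by rewrite ltr0n.
have step m : (m.+1%:R : R) * h = m%:R * h + h by rewrite -natr1 mulrDl mul1r.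
pose D m s := u s (m%:R * h) * u s (m.+1%:R * h)
            + v s (m%:R * h) * v s (m.+1%:R * h).
pose X m s := u s (m%:R * h) * v s (m.+1%:R * h)
            - v s (m%:R * h) * u s (m.+1%:R * h).
pose W s := \sum_(m < M) atan (X m s / D m s).
have D0 m s : 0 <= s <= 1 -> (m < M)%N -> 0 < D m s.
  move=> s01 mM; rewrite /D step; apply: dot0 => //.
  by rewrite mulr_ge0 ?(ltW h0)//= -[leRHS]Mh ler_pM2r// ler_nat ltnW.
(* The loop closes up, so rotation by [W s] keeps the direction of its starting vector. *)
have sinW s : 0 <= s <= 1 -> sin (W s) = 0.
  move=> s01.
  have := @rotation_sum_atan (fun m => u s (m%:R * h)) (fun m => v s (m%:R * h)) M.
  case=> [m mM|r r0]; first exact: D0.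
  rewrite -/(W s) Mh !mul0r; have [-> ->] := per s => -[eu ev].
  have q0 : 0 < u s 0 ^+ 2 + v s 0 ^+ 2.
    rewrite lt_def addr_ge0 ?sqr_ge0// andbT paddr_eq0 ?sqr_ge0// !sqrf_eq0.
    by apply/negP => /andP[/eqP a0 /eqP b0]; case: (uv0 s 0 s01); rewrite ?lexx ?ler01// => /eqP.
  have : r * sin (W s) * (u s 0 ^+ 2 + v s 0 ^+ 2) = 0.
    have -> : r * sin (W s) * (u s 0 ^+ 2 + v s 0 ^+ 2) =
      u s 0 * (r * (sin (W s) * u s 0 + cos (W s) * v s 0))
      - v s 0 * (r * (cos (W s) * u s 0 - sin (W s) * v s 0)) by ring.
    by rewrite -eu -ev; ring.
  by move=> /eqP; rewrite !mulf_eq0 (gt_eqF r0) (gt_eqF q0) orbF => /eqP.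
have W1 : W 1 = 0.
  rewrite /W big1// => m _; rewrite /X.
  have [-> ->] := uv1 (m%:R * h); have [-> ->] := uv1 (m.+1%:R * h).
  by rewrite [v 1 0 * _]mulrC subrr mul0r atan0.
have W0 : W 0 = 2 * pi * k%:R.
  pose d := 2 * pi * (k%:R * h).
  have d0 : - (pi / 2) < d < pi / 2.
    have dp : 0 < d by rewrite !mulr_gt0 ?pi_gt0.
    have kh : 4 * (k%:R * h) < 1.
      by rewrite mulrA -[ltRHS]Mh ltr_pM2r// -natrM ltr_nat.
    have pp : 0 < (pi : R) := pi_gt0 R.
    apply/andP; split; first lra.
    rewrite /d; nra.
  rewrite /W (eq_bigr (fun=> d)) => [|m _].
    rewrite sumr_const card_ord -mulr_natl /d.
    by rewrite -[RHS]mulr1 -[X in _ = _ * X]Mh; ring.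
  rewrite -[RHS]tanK ?in_itv//; congr atan; rewrite /X /D !u0E !v0E step.
  set x := 2 * pi * (k%:R * (m%:R * h)) + c.
  have -> : 2 * pi * (k%:R * (m%:R * h + h)) + c = x + d by rewrite /x /d; ring.
  have cd : cos d != 0 by rewrite gt_eqF// cos_gt0_pihalf.
  have dE : d = (x + d) - x by ring.
  have -> : A * cos x * (A * sin (x + d)) - A * sin x * (A * cos (x + d))
    = A ^+ 2 * sin d by rewrite [in RHS]dE sinB; ring.
  have -> : A * cos x * (A * cos (x + d)) + A * sin x * (A * sin (x + d))
    = A ^+ 2 * cos d by rewrite [in RHS]dE cosB; ring.
  rewrite /tan; field; rewrite A0 cd//.
have Wc : {within `[0, 1], continuous W}.
  apply: continuous_in_subspaceT => s; rewrite inE/= in_itv/= => s01.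
  apply: (@cvg_big _ _ _ _ xpredT (@add_continuous _)) => m _.
  have slice (w : R -> R -> R) (i : nat) : continuous (fun z : R * R => w z.1 z.2) ->
      w x (i%:R * h) @[x --> s] --> w s (i%:R * h).
    by move=> wC; exact: continuous_slice.
  suff : X m x / D m x @[x --> s] --> X m s / D m s.
    by move/(continuous_cvg _ (@continuous_atan R _)); exact.
  rewrite /X /D.
  apply: cvgM; last apply: cvgV; rewrite ?gt_eqF ?D0//.
    by apply: cvgB; apply: cvgM; exact: slice.
  by apply: cvgD; apply: cvgM; exact: slice.
have [] := @IVT R W 0 1 (pi / 2) ler01 Wc.
  have pk : (pi : R) / 2 <= 2 * pi * k%:R.
    have k1 : 1 <= (k%:R : R) by rewrite ler1n.
    by have := pi_gt0 R; nra.
  by rewrite W1 W0 ge_min le_max pk divr_ge0 ?pi_ge0// orbT.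
move=> s; rewrite in_itv/= => s01 Ws.
by move: (sinW s s01); rewrite Ws sin_pihalf => /eqP; rewrite oner_eq0.
Qed.

End Winding.

(** * The torus link *)

Lemma continuous_matrix (K T : topologicalType) (m n : nat) (f : T -> 'M[K]_(m, n)) :
  (forall i j, continuous (fun y => f y i j)) -> continuous f.
Proof.
move=> fC x A [P MP sPA]; suff : \forall y \near x, forall i j, P i j (f y i j).
  by apply: filterS => y Py; apply: sPA.
by apply: filter_forall => i; apply: filter_forall => j; exact: fC.
Qed.

Section Torus.
Context {R : realType}.
Implicit Types (a b c r s t th z : R) (x : 'rV[R]_3) (k : nat).

Lemma polar_coordinates a b : exists2 th, 0 <= th <= 2 * pi &
  a = Num.sqrt (a ^+ 2 + b ^+ 2) * cos th /\
  b = Num.sqrt (a ^+ 2 + b ^+ 2) * sin th.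
Proof.
set r := Num.sqrt _; have pi0 := pi_gt0 R.
have q0 : 0 <= a ^+ 2 + b ^+ 2 by rewrite addr_ge0 ?sqr_ge0.
have r2 : r ^+ 2 = a ^+ 2 + b ^+ 2 by rewrite sqr_sqrtr.
have [rz|rn] := eqVneq r 0.
  exists 0; first by lra.
  move: r2; rewrite rz expr0n/= => /esym/eqP.
  by rewrite paddr_eq0 ?sqr_ge0// !sqrf_eq0 => /andP[/eqP -> /eqP ->]; rewrite !mul0r.
have r0 : 0 < r by rewrite lt_def rn sqrtr_ge0.
have ar : -1 <= a / r <= 1.
  by rewrite ler_pdivlMr// ler_pdivrMr//; apply/andP; split; nra.
have ca : r * cos (acos (a / r)) = a by rewrite acosK ?in_itv//= mulrC divfK.
have sa : (r * sin (acos (a / r))) ^+ 2 = b ^+ 2.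
  by rewrite exprMn sin2cos2 mulrBr -exprMn ca r2; ring.
have s0 : 0 <= sin (acos (a / r)).
  by rewrite sin_ge0_pi// acos_ge0// acos_lepi.
have [b0|b0] := leP 0 b.
  exists (acos (a / r)).
    by rewrite acos_ge0//= (le_trans (acos_lepi ar))//; lra.
  split; first by rewrite ca.
  by apply/eqP; rewrite -(@eqrXn2 _ 2)// ?sa// mulr_ge0// ltW.
exists (pi *+ 2 - acos (a / r)).
  have := acos_ge0 ar; have := acos_lepi ar; rewrite mulr2n; lra.
rewrite cosB sinB cos2pi sin2pi !mul1r !mul0r addr0 sub0r ca; split=> //.
apply/eqP; rewrite mulrN -eqr_oppLR -(@eqrXn2 _ 2)// ?sqrrN ?sa//.
  by rewrite oppr_ge0 ltW.
by rewrite mulr_ge0// ltW.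
Qed.

Definition complex_pow k a b : R * R :=
  iter k (fun w => (a * w.1 - b * w.2, a * w.2 + b * w.1)) (1, 0).

Lemma complex_pow_polar k r th :
  complex_pow k (r * cos th) (r * sin th) =
  (r ^+ k * cos (k%:R * th), r ^+ k * sin (k%:R * th)).
Proof.
rewrite /complex_pow; elim: k => [|k IH] /=.
  by rewrite mul0r cos0 sin0 expr0 mulr1 mulr0.
rewrite IH/= -natr1 mulrDl mul1r cosD sinD exprS.
by congr (_, _); ring.
Qed.

Lemma continuous_complex_pow k (T : topologicalType) (f g : T -> R) :
  continuous f -> continuous g ->
  continuous (fun y => (complex_pow k (f y) (g y)).1) /\
  continuous (fun y => (complex_pow k (f y) (g y)).2).
Proof.
move=> fC gC; elim: k => [|k [IH1 IH2]] /=; first by split=> y; exact: cvg_cst.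
by split=> y; [apply: cvgB|apply: cvgD]; apply: cvgM;
  [exact: fC|exact: IH1|exact: gC|exact: IH2|exact: fC|exact: IH2|exact: gC|exact: IH1].
Qed.

(** * Equations of the components *)

Definition axis_dist x : R := Num.sqrt (x 0 0 ^+ 2 + x 0 1 ^+ 2).

(* Real and imaginary parts of [w - (x0 + i x1)^k e^(2 pi i c) / max(r, 1)^k], where
   [r = axis_dist x] and [w = (r - 2) + i x2]: near the torus this is
   [w - e^i(k theta + 2 pi c)], and the cutoff of the second term makes it continuous
   across the axis [r = 0] without new zeros. *)
Definition knot_eq1 k c x : R :=
  axis_dist x - 2 -
    (cos (2 * pi * c) * (complex_pow k (x 0 0) (x 0 1)).1
     - sin (2 * pi * c) * (complex_pow k (x 0 0) (x 0 1)).2) / Num.max (axis_dist x) 1 ^+ k.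
Definition knot_eq2 k c x : R :=
  x 0 2 -
    (cos (2 * pi * c) * (complex_pow k (x 0 0) (x 0 1)).2
     + sin (2 * pi * c) * (complex_pow k (x 0 0) (x 0 1)).1) / Num.max (axis_dist x) 1 ^+ k.

Lemma continuous_axis_dist : continuous axis_dist.
Proof.
move=> x; suff : (fun y : 'rV[R]_3 => y 0 0 * y 0 0 + y 0 1 * y 0 1) @ x -->
    x 0 0 * x 0 0 + x 0 1 * x 0 1.
  by move/(continuous_cvg _ (@sqrt_continuous R _)); exact.
have c0 := @coord_continuous R 1 3 0 0 x.
have c1 := @coord_continuous R 1 3 0 1 x.
exact: cvgD (cvgM c0 c0) (cvgM c1 c1).
Qed.

Lemma continuous_knot_eq k c :
  continuous (knot_eq1 k c) /\ continuous (knot_eq2 k c).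
Proof.
have [w1C w2C] := @continuous_complex_pow k _
  (fun x => x 0 0) (fun x => x 0 1) (@coord_continuous R 1 3 0 0) (@coord_continuous R 1 3 0 1).
have dC x : Num.max (axis_dist y) 1 ^- k @[y --> x] --> Num.max (axis_dist x) 1 ^- k.
  have m1 y : 1 <= Num.max (axis_dist y) 1 by rewrite le_max lexx orbT.
  have nz : Num.max (axis_dist x) 1 ^+ k != 0.
    by rewrite expf_neq0// gt_eqF// (lt_le_trans ltr01).
  have mC : (fun y => Num.max (axis_dist y) 1) @ x --> Num.max (axis_dist x) 1.
    apply: (@continuous_max _ _ axis_dist (fun=> 1)).
      exact: continuous_axis_dist.
    exact: cst_continuous.
  exact: cvgV nz (continuous_cvg _ (@exprn_continuous R k _) mC).
have cst (r : R) (x : 'rV[R]_3) : (fun=> r) @ x --> r.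
  exact: cst_continuous.
split=> x.
- exact: cvgB (cvgB (@continuous_axis_dist x) (cst _ _))
    (cvgM (cvgB (cvgM (cst _ _) (w1C x)) (cvgM (cst _ _) (w2C x))) (dC x)).
- exact: cvgB (@coord_continuous R 1 3 0 2 x)
    (cvgM (cvgD (cvgM (cst _ _) (w2C x)) (cvgM (cst _ _) (w1C x))) (dC x)).
Qed.

(** The curve going once along the parallel and [k] times along the meridian; the components of the
    torus link are those with [c = j / p]. *)
Definition knot k c t : 'rV[R]_3 := torus_point t (k%:R * t + c).

(** De Moivre's formula. The factor [s] is at most 1, and equals 1 once [r >= 1], in particular on
    the torus. *)
Lemma knot_eq_polar k c r th x : 0 <= r ->
  x 0 0 = r * cos th -> x 0 1 = r * sin th ->
  let s := (r / Num.max r 1) ^+ k in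
  let a := k%:R * th + 2 * pi * c in
  knot_eq1 k c x = r - 2 - s * cos a /\ knot_eq2 k c x = x 0 2 - s * sin a.
Proof.
move=> r0 x0 x1 s a.
have rE : axis_dist x = r.
  by rewrite /axis_dist x0 x1 !exprMn -mulrDr cos2Dsin2 mulr1 sqrtr_sqr ger0_norm.
rewrite /knot_eq1 /knot_eq2 rE x0 x1 complex_pow_polar /s /a exprMn exprVn cosD sinD.
by split=> //=; ring.
Qed.

Lemma knot_coords k c t : let ph := 2 * pi * (k%:R * t + c) in
  [/\ knot k c t 0 0 = (2 + cos ph) * cos (2 * pi * t),
   knot k c t 0 1 = (2 + cos ph) * sin (2 * pi * t) &
   knot k c t 0 2 = sin ph].
Proof. by split; rewrite mxE. Qed.

Lemma ord3_cases (P : 'I_3 -> Prop) : P 0 -> P 1 -> P 2 -> forall i, P i.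
Proof.
move=> P0 P1 P2 i; rewrite -[i]inord_val.
case: (i : nat) (ltn_ord i) => [|[|[|]]]// _.
- by rewrite (_ : inord 0 = 0)//; apply: val_inj; rewrite /= inordK.
- by rewrite (_ : inord 1 = 1)//; apply: val_inj; rewrite /= inordK.
- by rewrite (_ : inord 2 = 2)//; apply: val_inj; rewrite /= inordK.
Qed.

Lemma continuous_knot k c : continuous (knot k c).
Proof.
have linC (a b : R) : continuous (fun t : R => 2 * pi * (a * t + b)).
  move=> t; apply: cvgM; first exact: cst_continuous.
  apply: cvgD; last exact: cst_continuous.
  by apply: cvgM; [exact: cst_continuous|exact: cvg_id].
have cosC a b : continuous (fun t : R => cos (2 * pi * (a * t + b))).
  by move=> t; exact: (continuous_cvg _ (@continuous_cos R _) (linC a b t)).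
have sinC a b : continuous (fun t : R => sin (2 * pi * (a * t + b))).
  by move=> t; exact: (continuous_cvg _ (@continuous_sin R _) (linC a b t)).
have lin1 t : 2 * pi * t = 2 * pi * (1 * t + 0) :> R by ring.
have rC : continuous (fun t : R => 2 + cos (2 * pi * (k%:R * t + c))).
  by move=> t; apply: cvgD; [exact: cst_continuous|exact: cosC].
apply: continuous_matrix => i; rewrite [i]ord1; apply: ord3_cases.
- have -> : (fun t => knot k c t 0 0) =
      (fun t => (2 + cos (2 * pi * (k%:R * t + c))) * cos (2 * pi * (1 * t + 0))).
    by apply/funext => t; have [-> _ _] := knot_coords k c t; rewrite -lin1.
  by move=> t; apply: cvgM; [exact: rC|exact: cosC].
- have -> : (fun t => knot k c t 0 1) =
      (fun t => (2 + cos (2 * pi * (k%:R * t + c))) * sin (2 * pi * (1 * t + 0))).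
    by apply/funext => t; have [_ -> _] := knot_coords k c t; rewrite -lin1.
  by move=> t; apply: cvgM; [exact: rC|exact: sinC].
- have -> : (fun t => knot k c t 0 2) = (fun t => sin (2 * pi * (k%:R * t + c))).
    by apply/funext => t; have [_ _ ->] := knot_coords k c t.
  exact: sinC.
Qed.

Lemma knot_eq_knot k c c' t :
  knot_eq1 k c' (knot k c t) = cos (2 * pi * (k%:R * t + c)) - cos (2 * pi * (k%:R * t + c')) /\
  knot_eq2 k c' (knot k c t) = sin (2 * pi * (k%:R * t + c)) - sin (2 * pi * (k%:R * t + c')).
Proof.
have [x0 x1 x2] := knot_coords k c t.
have r1 : 1 <= 2 + cos (2 * pi * (k%:R * t + c)).
  by have := cos_geN1 (2 * pi * (k%:R * t + c)); lra.
have r0 := le_trans ler01 r1.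
have [-> ->] := knot_eq_polar k c' r0 x0 x1.
rewrite max_l// divff ?gt_eqF ?(lt_le_trans ltr01)// expr1n !mul1r x2.
have -> : k%:R * (2 * pi * t) + 2 * pi * c' = 2 * pi * (k%:R * t + c') by ring.
by split=> //; ring.
Qed.

(** At a zero, [r = 2 + s * cos a] with [0 <= s <= 1], hence [r >= 1]. Then the cutoff is inactive,
    [s = 1], and the equations are those of the knot. *)
Lemma knot_eq_zero k c x : knot_eq1 k c x = 0 -> knot_eq2 k c x = 0 ->
  (knot k c @` `[0, 1]) x.
Proof.
have [th th2 [x0 x1]] := polar_coordinates (x 0 0) (x 0 1).
set r := Num.sqrt _ in x0 x1; have r0 : 0 <= r := sqrtr_ge0 _.
have [-> ->] := knot_eq_polar k c r0 x0 x1.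
set s := _ ^+ k; set a := k%:R * _ + _ => e1 e2.
have m0 : 0 < Num.max r 1 by rewrite lt_max ltr01 orbT.
have s0 : 0 <= s by rewrite exprn_ge0// divr_ge0// ltW.
have s1 : s <= 1.
  by rewrite exprn_ile1// ?divr_ge0// ?(ltW m0)// ler_pdivrMr// mul1r le_max lexx.
have r1 : 1 <= r.
  have := cos_geN1 a; have : r - 2 = s * cos a by lra.
  nra.
have sE : s = 1 by rewrite /s max_l// divff ?expr1n// gt_eqF// (lt_le_trans ltr01).
rewrite sE !mul1r in e1 e2.
have pi0 := pi_gt0 R.
exists (th / (2 * pi)).
  by rewrite /= in_itv/= ler_pdivrMr ?mulr_gt0// divr_ge0//=; lra.
have thE : 2 * pi * (th / (2 * pi)) = th.
  by rewrite mulrC divfK// gt_eqF// mulr_gt0.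
have aE : 2 * pi * (k%:R * (th / (2 * pi)) + c) = a.
  by rewrite mulrDr mulrCA thE.
have [y0 y1 y2] := knot_coords k c (th / (2 * pi)); rewrite thE aE in y0 y1 y2.
apply/rowP; apply: ord3_cases.
- by rewrite y0 x0; congr (_ * _); lra.
- by rewrite y1 x1; congr (_ * _); lra.
- by rewrite y2; lra.
Qed.

Lemma knotD1 k c t : knot k c (t + 1) = knot k c t.
Proof.
have E a m : 2 * pi * (a + m%:R) = 2 * pi * a + pi *+ 2 *+ m :> R.
  by rewrite mulrDr -mulr_natr -(mulr_natr pi); ring.
have -> : knot k c (t + 1) = torus_point (t + 1%:R) (k%:R * t + c + k%:R).
  by rewrite /knot; congr torus_point; ring.
rewrite /knot /torus_point; apply/rowP => i; rewrite !mxE !E.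
by rewrite !(periodicn (@cosD2pi R)) !(periodicn (@sinD2pi R)).
Qed.

Lemma sin_half_sqr a : 2 * sin (pi * a) ^+ 2 = 1 - cos (2 * pi * a).
Proof.
have -> : 2 * pi * a = pi * a *+ 2 by rewrite mulr2n; ring.
by rewrite cos_mulr2n sin2cos2; ring.
Qed.

(** The vanishing of this sine encodes that [s - t] is an integer. The first two coordinates
    determine the positive distance to the axis, hence also the angle around it. *)
Lemma knot_inj k c s t : knot k c s = knot k c t -> sin (pi * (s - t)) = 0.
Proof.
have [s0 s1 _] := knot_coords k c s; have [t0 t1 _] := knot_coords k c t.
move=> st; rewrite {}st in s0 s1; move: s0 s1; rewrite {}t0 {}t1.
set r := 2 + _; set r' := 2 + _ => e0 e1.
have r0 : 0 < r by rewrite /r; have := cos_geN1 (2 * pi * (k%:R * t + c)); lra.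
have r'0 : 0 < r' by rewrite /r'; have := cos_geN1 (2 * pi * (k%:R * s + c)); lra.
have rr' : r = r'.
  have sq a b : 0 <= a -> a ^+ 2 = (a * cos b) ^+ 2 + (a * sin b) ^+ 2 :> R.
    by rewrite !exprMn -mulrDr cos2Dsin2 mulr1.
  apply/eqP; rewrite -(@eqrXn2 _ 2)// ?ltW//; apply/eqP.
  by rewrite (sq r (2 * pi * t)) ?(ltW r0)// e0 e1 -sq// ltW.
have rn : r' != 0 by rewrite gt_eqF.
move: e0 e1; rewrite rr' => /(mulfI rn) e0 /(mulfI rn) e1.
apply/eqP; rewrite -sqrf_eq0; apply/eqP.
have := sin_half_sqr (s - t).
rewrite (mulrBr (2 * pi)) cosB -e0 -e1 -!expr2 cos2Dsin2 subrr => /eqP.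
by rewrite mulf_eq0 pnatr_eq0/= => /eqP.
Qed.

(** Two points of the unit circle with a constant phase difference have a difference vector of
    constant length, here turning [k] times; the [pi / 2] is the argument of the factor i in the
    sum-to-product formula. *)
Lemma knot_eq_other k c c' t :
  let A := 2 * sin (pi * (c - c')) in
  let m := 2 * pi * (k%:R * t) + (pi * (c + c') + pi / 2) in
  knot_eq1 k c' (knot k c t) = A * cos m /\ knot_eq2 k c' (knot k c t) = A * sin m.
Proof.
have [-> ->] := knot_eq_knot k c c' t; move=> A m.
set a := 2 * pi * (k%:R * t) + pi * (c + c').
have -> : 2 * pi * (k%:R * t + c) = a + pi * (c - c') by rewrite /a; ring.
have -> : 2 * pi * (k%:R * t + c') = a - pi * (c - c') by rewrite /a; ring.
have -> : m = a + pi / 2 by rewrite /m /a addrA.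
rewrite cosDpihalf sinDpihalf; clearbody a; rewrite cosD cosB sinD sinB /A.
by split; ring.
Qed.

Lemma knot_eq_self k c t :
  knot_eq1 k c (knot k c t) = 0 /\ knot_eq2 k c (knot k c t) = 0.
Proof. by have [-> ->] := knot_eq_knot k c c t; rewrite !subrr. Qed.

(** The equations of the second knot vanish on it, but on the first their value has constant nonzero
    length. *)
Lemma knots_disjoint k c c' : sin (pi * (c - c')) != 0 ->
  range (knot k c) `&` range (knot k c') = set0.
Proof.
move=> cc'; apply/seteqP; split => // x [[s _ <-] [t _ ts]].
have [e1 e2] := knot_eq_self k c' t; rewrite ts in e1 e2.
have [] := knot_eq_other k c c' s; rewrite e1 e2.
move: (2 * pi * _ + _) => m u v.
have A0 : 2 * sin (pi * (c - c')) != 0 by rewrite mulf_neq0// pnatr_eq0.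
move: u v => /esym/eqP; rewrite mulf_eq0 (negbTE A0) => /eqP u.
move=> /esym/eqP; rewrite mulf_eq0 (negbTE A0) => /eqP v.
have := cos2Dsin2 m; rewrite u v => /eqP.
by rewrite expr0n/= addr0 eq_sym oner_eq0.
Qed.

Lemma knots_linked k c c' (h g : 'rV[R]_3 -> 'rV[R]_3) :
  continuous h -> continuous g -> cancel h g -> cancel g h -> (0 < k)%N ->
  sin (pi * (c - c')) != 0 ->
  convex_hull ((h \o knot k c) @` `[0, 1]) `&` (h \o knot k c') @` `[0, 1] !=set0.
Proof.
move=> hC gC hK gK k0 cc'; apply: contrapT => sep.
(* The straight-line contraction of the first curve to its base point: the curve at [s = 0], the
   point at [s = 1], always inside the convex hull. *)
pose P (s t : R) := s *: h (knot k c 0) + (1 - s) *: h (knot k c t).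
have PC : continuous (fun z : R * R => P z.1 z.2).
  have hkC : continuous (h \o knot k c).
    by move=> t; exact: (continuous_cvg _ (hC _) (@continuous_knot k c t)).
  move=> [s t]; have fC : (fun z : R * R => z.1) @ (s, t) --> s by exact: cvg_fst.
  have sC : (fun z : R * R => z.2) @ (s, t) --> t by exact: cvg_snd.
  apply: cvgD; apply: cvgZ.
  - exact: fC.
  - exact: cst_continuous.
  - by apply: cvgB; [exact: cst_continuous|exact: fC].
  - exact: (continuous_cvg _ (hkC t) sC).
have gPC : continuous (fun z : R * R => g (P z.1 z.2)).
  by move=> z; exact: (continuous_cvg _ (gC _) (PC z)).
have [u1C u2C] := continuous_knot_eq k c'.
have uC : continuous (fun z : R * R => knot_eq1 k c' (g (P z.1 z.2))).
  by move=> z; exact: (continuous_cvg _ (u1C _) (gPC z)).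
have vC : continuous (fun z : R * R => knot_eq2 k c' (g (P z.1 z.2))).
  by move=> z; exact: (continuous_cvg _ (u2C _) (gPC z)).
have A0 : 2 * sin (pi * (c - c')) != 0 by rewrite mulf_neq0// pnatr_eq0.
suff : k = 0%N by move=> kz; rewrite kz in k0.
apply: (@winding_not_null_homotopic R (fun s t => knot_eq1 k c' (g (P s t)))
  (fun s t => knot_eq2 k c' (g (P s t))) k _ (pi * (c + c') + pi / 2) uC vC _ _ _ _ _ A0).
(* A common zero would put [g (P s t)] on the second knot, and thus [P s t] in the intersection
   assumed empty. *)
- move=> s t s01 t01; apply: contrapT => /not_orP[/negP/negPn/eqP u0 /negP/negPn/eqP v0].
  apply: sep; exists (P s t); split.
    have /convex_setP := @convex_hull_convex _ _ ((h \o knot k c) @` `[0, 1]).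
    apply=> //; apply: sub_gen_smallest.
      by exists 0 => //=; rewrite in_itv/= lexx ler01.
    by exists t => //=; rewrite in_itv.
  have [r r01 rE] := knot_eq_zero u0 v0.
  by exists r => //=; rewrite rE gK.
- by move=> s; rewrite /P -[1]add0r knotD1.
- by move=> t; rewrite /P subrr !scale0r.
- by move=> t; rewrite /P subr0 scale0r scale1r add0r hK; have [] := knot_eq_other k c c' t.
- by move=> t; rewrite /P subr0 scale0r scale1r add0r hK; have [] := knot_eq_other k c c' t.
Qed.

End Torus.

(** * Planes and intersection counts *)

Lemma constant_sign (R : realType) (f : R -> R) (s t : R) :
  continuous f -> s <= t -> (forall r, s <= r <= t -> f r != 0) -> 0 < f s * f t.
Proof.
move=> fC st f0; rewrite ltNge; apply/negP => fst.
have [|r] := @IVT R f s t 0 st (continuous_subspaceT fC).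
  have fs0 : f s != 0 by rewrite f0// lexx.
  have ft0 : f t != 0 by rewrite f0// lexx st.
  rewrite ge_min le_max; have [fs|fs] := ltrP (f s) 0.
    by rewrite (ltW fs) -(nmulr_rle0 (f t) fs) fst orbT.
  have {}fs : 0 < f s by rewrite lt_neqAle eq_sym fs0.
  by rewrite -(pmulr_rle0 (f t) fs) fst orbT.
rewrite in_itv/= => /f0/negP r0 fr; apply: r0; exact/eqP.
Qed.

Section Planes.
Context {R : realType}.
Implicit Types (a x y : 'rV[R]_3) (b : R) (K L : set 'rV[R]_3).

Lemma continuous_height a b : continuous (height a b).
Proof.
move=> x; have sC : (fun y : 'rV[R]_3 => \sum_(i < 3) a 0 i * y 0 i) @ x -->
    \sum_(i < 3) a 0 i * x 0 i.
  apply: (@cvg_big _ _ _ _ xpredT (@add_continuous _)) => [|i _].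
    exact: (nbhs_filter x).
  have ai : (fun=> a 0 i) @ x --> a 0 i by exact: cst_continuous.
  exact: cvgM ai (@coord_continuous R 1 3 0 i x).
have bC : (fun=> b) @ x --> b by exact: cst_continuous.
exact: cvgB sC bC.
Qed.

(** The factor [e] treats both sides of the plane at once; it is later the height of a point of a
    component. *)
Lemma convex_half_space a b e : convex_set [set x | 0 < e * height a b x].
Proof.
apply/convex_setP => x y t /= x0 y0 t01.
have -> : height a b (t *: x + (1 - t) *: y) =
    t * height a b x + (1 - t) * height a b y.
  rewrite /height !mulrBr !mulr_sumr addrACA -big_split/=.
  congr (_ + _); last by ring.
  by apply: eq_bigr => i _; rewrite !mxE; ring.
case/andP: t01 => t0 t1; rewrite mulrDr !(mulrCA e).
have [->|tn] := eqVneq t 0; first by rewrite mul0r add0r subr0 mul1r.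
have tp : 0 < t by rewrite lt_neqAle eq_sym tn.
by apply: ltr_pwDl; [exact: mulr_gt0|rewrite mulr_ge0 ?subr_ge0// ltW].
Qed.

Lemma multiplicity_ge1 a b L x : (1 <= multiplicity a b L x)%E.
Proof.
rewrite /multiplicity; case: ifP => _; first by rewrite leey.
by case: ifP => _; rewrite lee_fin ?ler1n.
Qed.

Lemma multiplicity_ge2 a b L x : keeps_side a b L x -> (2%:E <= multiplicity a b L x)%E.
Proof.
move=> kx; rewrite /multiplicity; case: ifP => _; first by rewrite leey.
by rewrite asboolT.
Qed.

(** Two distinct intersection points count at least 1 each. If there is only one, the rest of the
    closed curve is connected and avoids the plane, so the curve keeps its side there and the point
    counts at least 2. The hypothesis on [L] makes this a statement about the whole link near the
    point. *)
Lemma curve_count_ge2 (f : R -> 'rV[R]_3) K L a b :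
  continuous f -> (forall t, f (t + 1) = f t) ->
  (forall s t, f s = f t -> sin (pi * (s - t)) = 0) ->
  K = f @` `[0, 1] -> (forall x, K x -> \forall y \near x, L y -> K y) ->
  plane a b `&` K !=set0 ->
  (2%:E <= \esum_(x in plane a b `&` K) multiplicity a b L x)%E.
Proof.
move=> fC fD1 finj KE LK [x [Sx Kx]].
have [[y [[Sy Ky] yx]]|uniq] := pselect (exists y, (plane a b `&` K) y /\ y <> x).
  apply: esum_ge; exists [set x; y].
    split; first exact: finite_set2.
    by move=> _ [->|->].
  rewrite fsbigU//=; last by move=> z [-> /esym].
  rewrite !fsbig_set1 (_ : 2%:E = 1%:E + 1%:E)%E; last by rewrite -EFinD.
  by rewrite leeD// multiplicity_ge1.
apply: esum_ge; exists [set x].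
  by split; [exact: finite_set1|move=> _ ->].
rewrite fsbig_set1; apply: multiplicity_ge2.
have xu y : K y -> height a b y = 0 -> y = x.
  by move=> Ky Sy; apply: contrapT => yx; apply: uniq; exists y.
pose g t := height a b (f t).
have gC : continuous g.
  by move=> t; exact: (continuous_cvg _ (@continuous_height a b _) (fC t)).
have gD1 t : g (t + 1) = g t by rewrite /g fD1.
have [t0 t01 fx] : (f @` `[0, 1]) x by rewrite -KE.
move: t01; rewrite /= in_itv/= => /andP[t00 t01].
have g0 : g t0 = 0 by rewrite /g fx.
have gn t : t0 < t < t0 + 1 -> g t != 0.
  move=> /andP[tt0 tt1]; apply/eqP => gt.
  have Kt : K (f t).
    rewrite KE; have [t1|t1] := leP t 1.
      by exists t => //=; rewrite in_itv/= t1 andbT ltW// (le_lt_trans t00).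
    exists (t - 1); last by rewrite -fD1 subrK.
    by rewrite /= in_itv/=; apply/andP; split; lra.
  have := finj t t0; rewrite fx => /(_ (xu _ Kt gt)) s0.
  have : 0 < sin (pi * (t - t0)).
    by have pi0 := pi_gt0 R; apply: sin_gt0_pi; apply/andP; split; nra.
  by rewrite s0 ltxx.
(* Reference side: the height half a period after the intersection point. *)
pose e := g (t0 + 2^-1).
have e0 : e != 0 by apply: gn; apply/andP; split; lra.
have ge t : t0 < t < t0 + 1 -> 0 < e * g t.
  move=> /andP[tt0 tt1]; have [h|/ltW h] := leP (t0 + 2^-1) t.
    by apply: constant_sign => // r /andP[r0 r1]; apply: gn; apply/andP; split; lra.
  by rewrite mulrC; apply: constant_sign => // r /andP[r0 r1]; apply: gn; apply/andP; split; lra.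
have Ke y : K y -> 0 <= e * height a b y.
  rewrite KE => -[t]; rewrite /= in_itv/= => /andP[tge0 tle1] <-; rewrite -/(g t).
  (* Parameters before [t0] are moved by one period into the interval from [t0] to [t0 + 1], where
     the sign is known. *)
  have [gt|gt] := eqVneq (g t) 0; first by rewrite gt mulr0.
  have [tt0|tt0|tt0] := ltgtP t0 t.
  - have t1 : t != t0 + 1 by apply: contra_neq gt => ->; rewrite gD1.
    by rewrite ltW// ge// tt0/= lt_neqAle t1; lra.
  - have t1 : t + 1 != t0 by apply: contra_neq gt => tE; rewrite -gD1 tE.
    by rewrite -gD1 ltW// ge// lt_neqAle eq_sym t1; apply/andP; split; lra.
  - by rewrite -tt0 g0 eqxx in gt.
have [ep|en] := ltrP 0 e; [left|right]; apply: filterS (LK x Kx) => y LKy Ly.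
  by rewrite -(pmulr_rge0 _ ep); apply: Ke; exact: LKy.
have {}en : e < 0 by rewrite lt_neqAle e0.
by rewrite -(nmulr_rge0 _ en); apply: Ke; exact: LKy.
Qed.

End Planes.

(** * Summing over the components and the final bound *)

Lemma intersection_count_ge (R : realType) (p : nat) (K : nat -> set 'rV[R]_3)
    (a : 'rV[R]_3) (b : R) (M : {set 'I_p}) :
  let L := \bigcup_(j in `I_p) K j in
  trivIset `I_p K ->
  (forall i, i \in M -> 2%:E <= \esum_(x in plane a b `&` K i) multiplicity a b L x)%E ->
  ((2 * #|M|)%:R%:E <= intersection_count a b L)%E.
Proof.
(* Padding with empty sets makes the family disjoint over all of [nat], as [esum_bigcupT]
   requires. *)
move=> L tK KM; pose J j := if (j < p)%N then plane a b `&` K j else set0.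
have tJ : trivIset setT J.
  move=> i j _ _ [x []]; rewrite /J; case: ifP => // ip [_ Ki].
  by case: ifP => // jp [_ Kj]; apply: tK => //; exists x.
have LJ : plane a b `&` L = \bigcup_(j in `I_p) J j.
  rewrite setI_bigcupr; apply: eq_bigcupr => j /= jp.
  by rewrite /J jp.
have m0 x : (0 <= multiplicity a b L x)%E.
  by apply: le_trans (multiplicity_ge1 a b L x); rewrite lee_fin.
rewrite /intersection_count LJ esum_bigcupT// esum_fset; last 2 first.
- exact: finite_II.
- by move=> j _; apply: esum_ge0.
rewrite -fsbig_ord.
have -> : ((2 * #|M|)%:R%:E = \sum_(i < p) (if i \in M then 2%:E else 0) :> \bar R)%E.
  by rewrite -big_mkcond/= sumEFin sumr_const mulrnA.
apply: lee_sum => i _; case: ifP => [/KM|_]; last exact: esum_ge0.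
by rewrite /J ltn_ord.
Qed.

(** The bound on [n] says that [n] is at most 3p/5 rounded up, which is [p] minus the largest number
    of components that a plane through the deep point can miss. *)
Lemma hull_knots_nonempty (R : realType) (p k n : nat) (h g : 'rV[R]_3 -> 'rV[R]_3) :
  (0 < k)%N -> (5 * n <= 3 * p + 4)%N ->
  continuous h -> continuous g -> cancel h g -> cancel g h ->
  hull n (\bigcup_(j in `I_p) (h \o knot k (j%:R / p%:R)) @` `[0, 1]) !=set0.
Proof.
move=> k0 np hC gC hK gK.
pose f (j : nat) := h \o knot k (j%:R / p%:R); pose K j := f j @` `[0, 1].
have fC j : continuous (f j).
  by move=> t; exact: (continuous_cvg _ (hC _) (@continuous_knot _ k _ t)).
(* Distinct phases differ by a nonzero number strictly between -1 and 1. *)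
have sin0 i j : (i < p)%N -> (j < p)%N -> i != j ->
    sin (pi * (i%:R / p%:R - j%:R / p%:R)) != 0 :> R.
  wlog ij : i j / (i < j)%N => [wl|] ip jp nij.
    have [ij|ij|ij] := ltngtP i j; first exact: wl.
      by rewrite -opprB mulrN sinN oppr_eq0; apply: wl => //; rewrite eq_sym.
    by rewrite ij eqxx in nij.
  have p0 : 0 < (p%:R : R) by rewrite ltr0n (leq_ltn_trans _ ip).
  have pi0 := pi_gt0 R.
  rewrite -opprB mulrN sinN oppr_eq0 -mulrBl gt_eqF// sin_gt0_pi//.
  rewrite mulr_gt0 ?divr_gt0 ?subr_gt0 ?ltr_nat//=.
  rewrite -[ltRHS]mulr1 ltr_pM2l// ltr_pdivrMr// mul1r -natrB 1?ltnW// ltr_nat.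
  by rewrite (leq_ltn_trans (leq_subr _ _)).
have tK : trivIset `I_p K.
  move=> i j ip jp [x [[s _ sx] [t _ tx]]]; apply/eqP; apply/negP => /negP ij.
  have /seteqP[/(_ (knot k (i%:R / p%:R) s)) + _] := knots_disjoint k (sin0 i j ip jp ij).
  apply; split; first by exists s.
  by exists t => //; apply: (can_inj hK); rewrite -[LHS]/(f j t) tx -sx.
have Kclosed j : closed (K j).
  apply: compact_closed; first exact: norm_hausdorff.
  apply: continuous_compact; last exact: segment_compact.
  exact: continuous_subspaceT.
have [||c cK] := @deep_point R p (fun i : 'I_p => K i).
- by move=> i; exists (f i 0); exists 0 => //=; rewrite in_itv/= lexx ler01.
- move=> i j ij; exact: knots_linked hC gC hK gK k0 (sin0 _ _ (ltn_ord i) (ltn_ord j) ij).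
exists c => a b a0 Sc.
pose M := [set i : 'I_p | `[< plane a b `&` K i !=set0 >]]%SET.
apply: (@le_trans _ _ (2 * #|M|)%:R%:E); last first.
  apply: (@intersection_count_ge R p K) => // i; rewrite inE => /asboolP Mi.
  apply: (curve_count_ge2 (fC i) _ _ (erefl _)) => //.
  - by move=> t; rewrite /f /= knotD1.
  - by move=> s t /(can_inj hK)/knot_inj.
  move=> x Kx.
  (* The other components are closed and avoid [x], so near [x] the link consists of [K i] alone. *)
  have : \forall y \near x, forall j : 'I_p, j != i -> ~ K j y.
    apply: (@filter_forall _ _ (fun (j : 'I_p) y => j != i -> ~ K j y) (nbhs x)) => j.
    have [->|ij] := eqVneq j i.
      by apply: nearW.
    have : \forall y \near x, (~` K j) y.
      apply: open_nbhs_nbhs; split; first exact: closed_openC.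
      move=> Kjx; move/eqP: ij; apply; apply: val_inj.
      by apply: tK => //=; exists x.
    by apply: filterS.
  apply: filterS => y Ky [j /= jp Kjy].
  have [ji|ji] := eqVneq (Ordinal jp) i; first by rewrite -ji.
  by have := Ky _ ji.
rewrite lee_fin ler_nat leq_mul2l/=.
suff : (5 * #|~: M| <= 2 * p)%N.
  have := cardsC M; rewrite card_ord.
  by move: (#|M|) (#|~: M|) => m m'; lia.
rewrite leqNgt; apply/negP => bigN.
have sgn (i : 'I_p) : i \in ~: M -> forall y, K i y -> 0 < height a b (f i 0) * height a b y.
  rewrite !inE => /asboolP Ni _ [t t01 <-].
  apply: (@constant_sign R (fun r => height a b (f i r))).
  - by move=> r; exact: (continuous_cvg _ (@continuous_height _ a b _) (fC i r)).
  - by move: t01; rewrite /= in_itv/= => /andP[].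
  - move=> r /andP[r0 rt]; apply/eqP => hr; apply: Ni; exists (f i r); split => //.
    exists r => //; rewrite /= in_itv/= r0 (le_trans rt)//.
    by move: t01; rewrite /= in_itv/= => /andP[].
have [i0 Ni0] : exists i0, i0 \in ~: M.
  apply/set0Pn; apply/eqP => N0; move: bigN; rewrite N0 cards0; lia.
(* All missed components lie on the side of the missed component [i0]; so does [c], being in the
   hull of their union, although it lies on the plane. *)
pose e := height a b (f i0 0).
have : 0 < e * height a b c.
  apply: (cK (~: M) bigN [set x | 0 < e * height a b x]); split; first exact: convex_half_space.
  move=> y [i /= Ni Kiy] /=.
  have [ii|ii] := eqVneq i i0; first by apply: sgn => //; rewrite -ii.
  (* The point [x] of [K i0] lies in the hull of [K i], so it is on the side of both components. *)
  have [x [Hx Kx]] := knots_linked hC gC hK gK k0 (sin0 _ _ (ltn_ord i) (ltn_ord i0) ii).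
  have ix : 0 < height a b (f i 0) * height a b x.
    apply: (Hx [set x | 0 < height a b (f i 0) * height a b x]); split; first exact: convex_half_space.
    by move=> z Kz; exact: sgn.
  have i0x := sgn _ Ni0 _ Kx; have iy := sgn _ Ni _ Kiy.
  move: ix i0x iy; rewrite -/e; set ei := height a b (f i 0).
  set hx := height a b x; set hy := height a b y => ix i0x iy.
  have : 0 < (e * hy) * (ei * hx) ^+ 2.
    have -> : e * hy * (ei * hx) ^+ 2 = (e * hx) * (ei * hx) * (ei * hy) by ring.
    exact: mulr_gt0 (mulr_gt0 i0x ix) iy.
  by rewrite pmulr_lgt0// exprn_gt0.
by rewrite Sc mulr0 ltxx.
Qed.

Lemma torus_curves_knots (R : realType) (p k : nat) : (0 < p)%N ->
  @torus_curves R p (k * p) =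
  \bigcup_(j in `I_p) knot k (j%:R / p%:R) @` `[0, 1].
Proof.
move=> p0; rewrite /torus_curves (gcdn_idPl (dvdn_mull k (dvdnn p))).
rewrite divnn p0 mulnK//; apply: eq_bigcupr => j _.
by apply: eq_imagel => t _; rewrite /knot mul1r.
Qed.

Theorem theorem1 (R : realType) (p q : nat)
    (hp : (0 < p)%N) (hq : (0 < q)%N) (hpq : (p %| q)%N) :
  (((3 / 5 * p%:R)%R : R)%:E <= hull_number (torus_link R p q))%E.
Proof.
have [k qE] := dvdnP hpq; have k0 : (0 < k)%N by case: k qE hq => // ->.
(* This is 3p/5 rounded up. *)
pose n := ((3 * p + 4) %/ 5)%N.
apply: (@le_trans _ _ n%:R%:E).
  have : (3 * p <= 5 * n)%N by rewrite /n; lia.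
  by rewrite -(ler_nat R) !natrM lee_fin; lra.
apply: ereal_sup_ubound; exists n => // L [_ [H [_ Hh _ <-]]].
have [|g [hC gC hK gK]] := Hh 1; first by rewrite in_itv/= ler01 lexx.
rewrite qE torus_curves_knots// image_bigcup; under eq_bigcupr do rewrite image_comp.
by apply: hull_knots_nonempty hC gC hK gK => //; rewrite mulnC leq_divM.
Qed.
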